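(* Let $1\le k\le d$ be integers, $\varepsilon>0$, and let $D$ be a dataset over $d$ items. Let $c_1\ge\dots\ge c_k$ denote the true top-$k$ counts of $D$. Let $S=(s_1,\dots,s_k)$ be a random sequence in $[d]^k$ drawn with probability $$\mathbb{P}[S]=\frac{\exp\left(\varepsilon u^*(D,S)/2\right)}{\sum_{S'\in[d]^k}\exp\left(\varepsilon u^*(D,S')/2\right)},$$ and let $\tilde c_i=\mathrm{cnt}_D(s_i)$ be the counts of the output items. Then with probability at least $99/100$, $$\max_{i\in[k]}(c_i-\tilde c_i)\le\frac{2\left[k\ln(d)+5\right]}{\varepsilon}.$$
   Context: $[m]=\{1,\dots,m\}$. There are $d$ items, identified with $[d]$. A dataset $D=\{x_1,\dots,x_n\}$ is a finite multiset of user vectors $x_i\in\{0,1\}^d$; the count of item $j$ is $\mathrm{cnt}_D(j)=\sum_{i=1}^n x_{i,j}$. Let $c_1\ge c_2\ge\dots\ge c_d$ be the item counts of $D$ sorted in nonincreasing order. For a sequence $S=(s_1,\dots,s_k)\in[d]^k$ define $$u^*(D,S)=\begin{cases}-\max_{i\in[k]}\left(c_i-\mathrm{cnt}_D(s_i)\right)&\text{if } s_1,\dots,s_k \text{ are distinct},\\ -\infty&\text{otherwise,}\end{cases}$$ with the convention $\exp(-\infty)=0$. *)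

(* Defs.v *)
From HB Require Import structures.
From mathcomp Require Import all_boot all_order all_algebra.
From mathcomp Require Import finmap multiset.
From mathcomp Require Import all_classical all_reals all_analysis.

Set Implicit Arguments.
Unset Strict Implicit.
Unset Printing Implicit Defensive.

Import Order.TTheory GRing.Theory Num.Theory.

Local Open Scope ring_scope.

(* Items are numbered from 0, so [d] is 'I_d; indices of sequences and of the
   sorted counts are shifted down by one accordingly. *)

Definition dataset (d : nat) := {mset {ffun 'I_d -> bool}}%mset.

Definition cnt (d : nat) (D : dataset d) (j : 'I_d) : nat :=
  (\sum_(x <- enum_mset D) x j)%N.

(* sorted_cnt D i is c_(i+1); the default value 0 is only reached if d <= i. *)
Definition sorted_cnt (d : nat) (D : dataset d) (i : nat) : nat :=
  nth 0%N (sort geq [seq cnt D j | j <- enum 'I_d]) i.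

(* The differences are signed. The maximum is taken in \bar R with unit -oo,
   so that for 0 < k it is the true maximum, negative values included. *)
Definition max_gap (R : realType) (d k : nat) (D : dataset d)
    (S : k.-tuple 'I_d) : \bar R :=
  \big[maxe/-oo%E]_(i < k) ((sorted_cnt D i)%:R - (cnt D (tnth S i))%:R)%:E.

Definition ustar (R : realType) (d k : nat) (D : dataset d)
    (S : k.-tuple 'I_d) : \bar R :=
  if uniq S then (- max_gap R D S)%E else -oo%E.

(* expeR extends the exponential to \bar R, with expeR -oo = 0. *)
Definition sampling_prob (R : realType) (d k : nat) (eps : R) (D : dataset d)
    (S : k.-tuple 'I_d) : \bar R :=
  (expeR (eps%:E * ustar R D S / 2%:E)
   / \sum_(S' : k.-tuple 'I_d) expeR (eps%:E * ustar R D S' / 2%:E))%E.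

(* Main.v *)
(* The greedy sequence listing the k most frequent items has gap 0, so the
   normalizing constant is at least 1. A sequence whose gap exceeds the bound
   has weight at most exp(-(k ln d + 5)) = d^-k e^-5, and there are only d^k
   sequences, so the bad event has probability at most e^-5 < 1/100. *)

Require Import Defs.
From mathcomp Require Import all_boot all_order all_algebra.
From mathcomp Require Import ring lra.
From mathcomp Require Import all_classical all_reals all_analysis.

Import Order.TTheory GRing.Theory Num.Theory.

Local Open Scope classical_set_scope.
Local Open Scope ring_scope.

Lemma expR5_ge100 (R : realType) : (100 : R) <= expR 5.
Proof.
have -> : (5 : R) = 10%:R * (1 / 2) by lra.
rewrite expRM_natl.
(* 1.6 <= 1.1^5 <= e^(1/2) and 1.6^10 > 100 *)
have h : (16 / 10 : R) <= expR (1 / 2).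
  have -> : (1 / 2 : R) = 5%:R * (1 / 10) by lra.
  rewrite expRM_natl.
  have h0 : (11 / 10 : R) <= expR (1 / 10).
    by apply: le_trans (expR_ge1Dx _); lra.
  apply: (@le_trans _ _ ((11 / 10) ^+ 5)); first by rewrite !exprS expr0; lra.
  by rewrite lerXn2r // nnegrE ?expR_ge0 //; lra.
apply: (@le_trans _ _ ((16 / 10) ^+ 10)); first by rewrite !exprS expr0; lra.
by rewrite lerXn2r // nnegrE ?expR_ge0 //; lra.
Qed.

Lemma content_bigsetU_le (disp : measure_display) (T : measurableType disp)
    (R : realType) (mu : {measure set T -> \bar R}) (I : Type) (r : seq I)
    (Q : pred I) (A : I -> set T) (mA : forall i, measurable (A i)) :
  (mu (\big[setU/set0]_(i <- r | Q i) A i) <= \sum_(i <- r | Q i) mu (A i))%E.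
Proof.
elim: r => [|i r IH]; first by rewrite !big_nil measure0.
rewrite !big_cons; case: (Q i) => //.
have mU : measurable (\big[setU/set0]_(j <- r | Q j) A j).
  by apply: bigsetU_measurable.
by apply: le_trans (measureU2 mu (mA i) mU) _; exact: leeD2l.
Qed.

Section Sampling.

Context (R : realType) (d k : nat) (eps : R) (D : dataset d).
Hypotheses (k_led : (k <= d)%N) (eps_gt0 : 0 < eps).

Let weight (s : k.-tuple 'I_d) : \bar R :=
  expeR (eps%:E * ustar R D s / 2%:E)%E.

(** Sort the items themselves by decreasing count and keep the first [k]. Mapping [cnt D] over the
    sorted items gives the sorted counts, however ties are broken. *)
Lemma exists_top_tuple : exists s : k.-tuple 'I_d,
  uniq s /\ forall i : 'I_k, cnt D (tnth s i) = sorted_cnt D i.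
Proof.
pose t := sort (relpre (cnt D) geq) (enum 'I_d).
have sz : size (take k t) == k by rewrite size_takel // size_sort size_enum_ord.
exists (Tuple sz); split.
  by rewrite /= take_uniq // sort_uniq enum_uniq.
(* The index [i] witnesses [0 < k <= d], which supplies a default item for [nth]. *)
move=> i; have x0 : 'I_d by case: (i) => m mk; exact: Ordinal (leq_trans mk k_led).
rewrite /sorted_cnt sort_map (nth_map x0) ?size_sort ?size_enum_ord; last first.
  exact: leq_trans k_led.
by rewrite (tnth_nth x0) /= nth_take.
Qed.

Lemma normalizer_ge1 : (1 <= \sum_(s : k.-tuple 'I_d) weight s)%E.
Proof.
have [s [us sE]] := exists_top_tuple.
(* An inequality rather than an equality, since for [k = 0] the empty maximum is [-oo]. *)
have gap0 : (max_gap R D s <= 0)%E.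
  apply: bigmax_le => [|i _]; first exact: leNye.
  by rewrite sE subrr.
have w1 : (1 <= weight s)%E.
  rewrite -expeR0 lee_expeR /ustar us.
  apply: mule_ge0; last by rewrite inve_ge0 lee_fin.
  by apply: mule_ge0; rewrite ?oppe_ge0 // lee_fin ltW.
rewrite (bigD1 s) //=; apply: le_trans w1 _.
by rewrite leeDl //; apply: sume_ge0 => i _; exact: expeR_ge0.
Qed.

(** Dividing by a normalizer that is at least 1 cannot increase a nonnegative weight. *)
Lemma sampling_prob_le_weight (s : k.-tuple 'I_d) :
  (sampling_prob eps D s <= weight s)%E.
Proof.
rewrite /sampling_prob -[leRHS]mule1; apply: lee_wpmul2l; first exact: expeR_ge0.
have Z_ge1 := normalizer_ge1.
by rewrite -[leRHS]inve1 lee_pV2 // inE // (le_trans _ Z_ge1).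
Qed.

Lemma weight_le_of_gap (B : R) (s : k.-tuple 'I_d) :
  (B%:E < max_gap R D s)%E -> (weight s <= (expR (- (eps * B / 2)))%:E)%E.
Proof.
move=> gapB; rewrite -[leRHS]/(expeR (- (eps * B / 2))%:E) lee_expeR /ustar.
(* Inversion in [\bar R] branches on whether the real is zero; this selects the finite branch. *)
have half_ne0 : (2 : R) == 0 = false by apply/eqP; lra.
have eps0 := eps_gt0.
(* Covers the two degenerate cases below: repeated items, and a gap equal to [+oo]. *)
have NyE : (eps%:E * -oo / 2%:E = -oo)%E.
  by rewrite gt0_muleNy ?lte_fin // inver half_ne0 gt0_mulNye ?lte_fin ?invr_gt0.
case: ifP => [_|_]; last by rewrite NyE leNye.
case: (max_gap R D s) gapB => [g|_|//]; last by rewrite NyE leNye.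
rewrite lte_fin => gapB.
rewrite inver half_ne0 -EFinN -!EFinM lee_fin mulrN mulNr lerN2.
by rewrite ler_wpM2r // ?ler_wpM2l ?ltW ?invr_gt0.
Qed.

End Sampling.

Theorem theorem3p3 (R : realType) (d k : nat) (eps : R) (D : dataset d)
    (disp : measure_display) (Omega : measurableType disp)
    (P : probability Omega R) (S : Omega -> k.-tuple 'I_d)
    (k_ge1 : (1 <= k)%N) (k_led : (k <= d)%N) (eps_gt0 : 0 < eps)
    (S_measurable : forall A : set (k.-tuple 'I_d), measurable (S @^-1` A))
    (S_distribution : forall s : k.-tuple 'I_d,
        P (S @^-1` [set s]) = sampling_prob eps D s) :
  ((99 / 100 : R)%:E <=
   P [set w | (max_gap R D (S w)
               <= (2 * (k%:R * ln d%:R + 5) / eps)%:E)%E])%E.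
Proof.
set B := 2 * _ / eps.
pose bad (s : k.-tuple 'I_d) := (B%:E < max_gap R D s)%E.
have d_gt0 : 0 < d%:R :> R by rewrite ltr0n; exact: leq_trans k_led.
have dk_gt0 : 0 < d%:R ^+ k :> R by rewrite exprn_gt0.
(* [B] is scaled so that the exponent is [k ln d + 5]: the first term pays for the union bound over
   [d ^ k] tuples, the second for the failure probability. *)
have wB : expR (- (eps * B / 2)) <= (d%:R ^+ k)^-1 / 100.
  have -> : eps * B / 2 = k%:R * ln d%:R + 5.
    by rewrite /B; field; rewrite gt_eqF.
  rewrite opprD expRD !expRN expRM_natl lnK ?posrE //.
  apply: ler_wpM2l; first by rewrite invr_ge0 ltW.
  by rewrite lef_pV2 ?posrE ?expR_gt0 ?expR5_ge100.
(* The law of [S] is known on single tuples, so the bad event is cut into finitely many fibres of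
   [S]. *)
have badE : ~` [set w | (max_gap R D (S w) <= B%:E)%E]
    = \big[setU/set0]_(s <- enum {: k.-tuple 'I_d} | bad s) (S @^-1` [set s]).
  rewrite -bigcup_seq_cond; apply/seteqP; split => w /=.
    move=> /negP; rewrite -ltNge => h.
    by exists (S w) => //=; rewrite mem_enum.
  by move=> [s /= /andP[_ bs] sE]; rewrite sE; apply/negP; rewrite -ltNge.
have Pbad : (P (~` [set w | (max_gap R D (S w) <= B%:E)%E]) <= (1 / 100)%:E)%E.
  rewrite badE; apply: le_trans (content_bigsetU_le _ _ _ _ _ _ _ _ _) _ => //.
  (* The sum is enlarged from the bad tuples to all tuples, so that only their number [d ^ k]
     matters. *)
  apply: (@le_trans _ _
    (\sum_(s <- enum {: k.-tuple 'I_d}) ((d%:R ^+ k)^-1 / 100)%:E)%E).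
    rewrite big_mkcond; apply: lee_sum => s _; case: ifP => [bs|_]; last first.
      by rewrite lee_fin divr_ge0 // invr_ge0 ltW.
    apply: (@le_trans _ _ (sampling_prob eps D s)).
      by rewrite -S_distribution.
    apply: le_trans (sampling_prob_le_weight _ _ _ _ _ _ _ _) _ => //.
    by apply: le_trans (weight_le_of_gap _ _ _ _ _ _ _ _ bs) _.
  rewrite big_enum sumEFin lee_fin sumr_const card_tuple card_ord.
  by rewrite -[leLHS]mulr_natl natrX mulrA divff ?gt_eqF.
have mE := S_measurable [set s | (max_gap R D s <= B%:E)%E].
rewrite probability_setC // in Pbad.
(* The probability is finite, so the complement rule becomes a linear inequality in [R]. *)
move: Pbad; rewrite -(fineK (fin_num_measure P _ mE)) -EFinB !lee_fin.
by set p := fine _ => hp; lra.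
Qed.
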